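(* Suppose that $\mu=\delta_0'$ (the derivative of the Dirac delta measure at zero) and let $\rho(u)=\lambda u$ with $\lambda\neq0$. Then the stochastic integral equation $$u(t,x)=J_0(t,x)+\iint_{[0,t]\times\mathbb{R}}G_\nu(t-s,x-y)\,\rho(u(s,y))\,W(ds,dy)$$ does not have a random field solution.
   Context: $\nu>0$ is fixed, $\mathbb{R}_+^*=\,]0,\infty[$, $G_\nu(t,x)=\frac{1}{\sqrt{2\pi\nu t}}e^{-x^2/(2\nu t)}$ for $t>0$, $G_\nu(t,\cdot)\equiv0$ for $t\le0$. $J_0(t,x)=(\mu*G_\nu(t,\cdot))(x)$ is the solution of the homogeneous heat equation with initial data $\mu$; for $\mu=\delta_0'$, $J_0(t,x)=\frac{\partial}{\partial x}G_\nu(t,x)=-\frac{x}{\nu t}G_\nu(t,x)$. $\|\cdot\|_2$ is the $L^2(\Omega)$-norm and $(f\star g)(t,x)=\int_0^tds\int_{\mathbb{R}}dy\,f(s,y)g(t-s,x-y)$. $W$ is space-time white noise on $\mathbb{R}_+\times\mathbb{R}$ on a complete probability space $(\Omega,\mathcal{F},P)$, with natural filtration $(\mathcal{F}_t)$ augmented by the $P$-null sets; the stochastic integral is the Walsh integral. A process $u=(u(t,x),(t,x)\in\mathbb{R}_+^*\times\mathbb{R})$ is a random field solution if: (1) $u(t,x)$ is $\mathcal{F}_t$-measurable for all $(t,x)$; (2) $u$ is jointly measurable with respect to $\mathcal{B}(\mathbb{R}_+^*\times\mathbb{R})\times\mathcal{F}$; (3) $(G_\nu^2\star\|\rho(u)\|_2^2)(t,x)<+\infty$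 for all $(t,x)\in\mathbb{R}_+^*\times\mathbb{R}$, and $(t,x)\mapsto I(t,x):=\iint_{[0,t]\times\mathbb{R}}G_\nu(t-s,x-y)\rho(u(s,y))W(ds,dy)$ is continuous from $\mathbb{R}_+^*\times\mathbb{R}$ into $L^2(\Omega)$; (4) $u(t,x)=J_0(t,x)+I(t,x)$ a.s., for all $(t,x)\in\mathbb{R}_+^*\times\mathbb{R}$. *)

(* Defs.v *)
From HB Require Import structures.
From mathcomp Require Import all_boot all_order all_algebra.
From mathcomp Require Import all_classical all_reals all_analysis.

Set Implicit Arguments.
Unset Strict Implicit.
Unset Printing Implicit Defensive.

Import Order.TTheory GRing.Theory Num.Theory.
Import numFieldNormedType.Exports.

Local Open Scope classical_set_scope.
Local Open Scope ring_scope.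

Definition heat_kernel (R : realType) (nu t x : R) : R :=
  if 0 < t then
    (Num.sqrt (2 * pi * nu * t))^-1 * expR (- (x ^+ 2) / (2 * nu * t))
  else 0.

(* The initial datum is a distribution, i.e. a functional on test functions.  *)
(* The convolution of mu with a smooth function g is x |-> <mu, g (x - .)>.   *)
Definition delta0_prime (R : realType) (phi : R -> R) : R := - derive1 phi 0.

Definition J0 (R : realType) (nu : R) (mu : (R -> R) -> R) (t x : R) : R :=
  mu (fun y => heat_kernel nu t (x - y)).

(* Time integrals run over the open interval ]0, t[: a process indexed by     *)
(* ]0, +oo[ x R has no value at time 0, and the two endpoints are             *)
(* Lebesgue-null.                                                             *)
Definition star (R : realType) (f g : R -> R -> \bar R) (t x : R) : \bar R :=
  (\int[lebesgue_measure]_(s in `]0%R, t[)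
    \int[lebesgue_measure]_(y in [set: R]) (f s y * g (t - s)%R (x - y)%R))%E.

Definition norm2 (d : measure_display) (T : measurableType d) (R : realType)
    (P : probability T R) (X : T -> R) : \bar R :=
  'N[P]_(2%:E)[EFin \o X]%E.

Definition area (R : realType) : set (R * R) -> \bar R :=
  (@lebesgue_measure R \x @lebesgue_measure R)%E.

(* Points of the plane are (time, space). *)
Definition noise_domain (R : realType) (A : set (R * R)) : Prop :=
  [/\ measurable A, A `<=` [set z : R * R | 0 <= z.1] & (area A < +oo)%E].

(* normal_prob 0 0 is not the degenerate law, hence the case distinction. *)
Definition centered_gaussian (R : realType) (v : R) (E : set R) : \bar R :=
  if v == 0 then dirac (0 : R) E else normal_prob 0 (Num.sqrt v) E.

(* White noise as a Gaussian random measure independently scattered over      *)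
(* disjoint sets (Walsh). The product rule for subfamilies is the case where  *)
(* some of the E i are setT. Values of W outside noise_domain are irrelevant. *)
Record white_noise (d : measure_display) (T : measurableType d) (R : realType)
    (P : probability T R) (W : set (R * R) -> T -> R) : Prop := {
  white_noise_measurable : forall A, noise_domain A ->
    measurable_fun [set: T] (W A) ;
  white_noise_gaussian : forall A, noise_domain A ->
    forall E : set R, measurable E ->
      P (W A @^-1` E) = centered_gaussian (fine (area A)) E ;
  white_noise_additive : forall A B, noise_domain A -> noise_domain B ->
    A `&` B = set0 ->
    {ae P, forall w, W (A `|` B) w = W A w + W B w} ;
  white_noise_independent : forall (n : nat) (A : 'I_n -> set (R * R)),
    (forall i, noise_domain (A i)) ->
    (forall i j : 'I_n, i != j -> A i `&` A j = set0) ->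
    forall E : 'I_n -> set R, (forall i, measurable (E i)) ->
      P (\bigcap_(i in [set: 'I_n]) (W (A i) @^-1` E i)) =
      (\prod_(i < n) P (W (A i) @^-1` E i))%E
}.

Definition noise_filtration (d : measure_display) (T : measurableType d)
    (R : realType) (P : probability T R) (W : set (R * R) -> T -> R) (t : R) :
    set (set T) :=
  <<s [set F | exists (A : set (R * R)) (E : set R),
                 [/\ noise_domain A, A `<=` [set z : R * R | z.1 <= t],
                     measurable E & F = W A @^-1` E]]
      `|` [set N | measurable N /\ P N = 0%E] >>.

Definition measurable_wrt (T : Type) (R : realType) (F : set (set T))
    (X : T -> R) : Prop :=
  forall E : set R, measurable E -> F (X @^-1` E).

(* The elementary process X(w) 1_]a, b](s) 1_A(y). *)
Record elementary (T : Type) (R : realType) := Elementary {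
  el_coef : T -> R ;
  el_start : R ;
  el_end : R ;
  el_space : set R
}.

Definition elementary_wf (d : measure_display) (T : measurableType d)
    (R : realType) (P : probability T R) (W : set (R * R) -> T -> R)
    (e : elementary T R) : Prop :=
  [/\ 0 <= el_start e < el_end e,
      measurable_wrt (noise_filtration P W (el_start e)) (el_coef e),
      (exists M, forall w, `|el_coef e w| <= M),
      measurable (el_space e) &
      (lebesgue_measure (el_space e) < +oo)%E].

Definition elementary_eval (T : Type) (R : realType) (e : elementary T R)
    (s y : R) (w : T) : R :=
  el_coef e w * \1_(`]el_start e, el_end e] : set R) s * \1_(el_space e) y.

Definition elementary_int (T : Type) (R : realType)
    (W : set (R * R) -> T -> R) (t : R) (e : elementary T R) (w : T) : R :=
  el_coef e w *
  W (`]Num.min (el_start e) t, Num.min (el_end e) t] `*` el_space e) w.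

Record simple (T : Type) (R : realType) := Simple {
  simple_size : nat ;
  simple_term : 'I_simple_size -> elementary T R
}.
Arguments simple_term {T R} s i.

Definition simple_wf (d : measure_display) (T : measurableType d)
    (R : realType) (P : probability T R) (W : set (R * R) -> T -> R)
    (S : simple T R) : Prop :=
  forall i, elementary_wf P W (simple_term S i).

Definition simple_eval (T : Type) (R : realType) (S : simple T R)
    (s y : R) (w : T) : R :=
  \sum_i elementary_eval (simple_term S i) s y w.

Definition simple_int (T : Type) (R : realType) (W : set (R * R) -> T -> R)
    (t : R) (S : simple T R) (w : T) : R :=
  \sum_i elementary_int W t (simple_term S i) w.

(* I is (a version of) the Walsh integral of f over [0, t] x R: it is the     *)
(* L^2(Omega) limit of the integrals of simple processes converging to f in   *)
(* L^2([0, t] x R x Omega). By the Ito isometry, I is unique up to null sets, *)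
(* and does not depend on the approximating sequence.                         *)
Definition is_walsh_integral (d : measure_display) (T : measurableType d)
    (R : realType) (P : probability T R) (W : set (R * R) -> T -> R) (t : R)
    (f : R -> R -> T -> R) (I : T -> R) : Prop :=
  [/\ measurable_fun [set z : (R * R) * T | 0 < z.1.1 < t]
        (fun z => f z.1.1 z.1.2 z.2),
      I \in Lfun P 2%:E &
      exists S : nat -> simple T R,
        [/\ forall n, simple_wf P W (S n),
            (\int[lebesgue_measure]_(s in `]0%R, t[)
              \int[lebesgue_measure]_(y in [set: R])
                norm2 P (fun w => simple_eval (S n) s y w - f s y w)%R ^+ 2)%E
              @[n --> \oo] --> 0%E &
            norm2 P (fun w => simple_int W t (S n) w - I w)
              @[n --> \oo] --> 0%E]].

(* u is a random field solution, on ]0, +oo[ x R, of the equation with        *)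
(* nonlinearity rho driven by W, with initial datum mu.                       *)
Definition random_field_solution (d : measure_display) (T : measurableType d)
    (R : realType) (P : probability T R) (W : set (R * R) -> T -> R) (nu : R)
    (rho : R -> R) (mu : (R -> R) -> R) (u : R -> R -> T -> R) : Prop :=
  [/\ forall t x : R, 0 < t -> measurable_wrt (noise_filtration P W t) (u t x),
      measurable_fun [set z : (R * R) * T | 0 < z.1.1]
        (fun z => u z.1.1 z.1.2 z.2),
      forall t x : R, 0 < t ->
        (star (fun s y => (heat_kernel nu s y ^+ 2)%:E)
              (fun s y => norm2 P (fun w => rho (u s y w)) ^+ 2) t x < +oo)%E &
      exists I : R -> R -> T -> R,
        [/\ forall t x : R, 0 < t ->
              is_walsh_integral P W t
                (fun s y w => heat_kernel nu (t - s) (x - y) * rho (u s y w))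
                (I t x),
            forall t x : R, 0 < t ->
              norm2 P (fun w => I z.1 z.2 w - I t x w)
                @[z --> (t, x)] --> 0%E &
            forall t x : R, 0 < t ->
              {ae P, forall w, u t x w = J0 nu mu t x + I t x w}]].

(* Main.v *)
(* A solution would satisfy E[u(t, x)] = J0(t, x), because Walsh integrals    *)
(* are centered: a simple integrand is a bounded variable X of the past times *)
(* the noise of a set lying in the future, and these are independent. Hence   *)
(* ||u(t, x)||_2 >= |J0(t, x)|. For mu = delta_0', |J0(t, y)| is of order     *)
(* t^-1 when y is of order sqrt t, so J0^2 is of order e^-4 on a parabolic    *)
(* box of size e^2 x e, and the integral defining the convolution of G^2 with *)
(* ||rho(u)||_2^2 is at least of order e^-1 for every small e, hence          *)
(* infinite.                                                                  *)

Require Import Defs.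
From HB Require Import structures.
From mathcomp Require Import all_boot all_order all_algebra.
From mathcomp Require Import all_classical all_reals all_analysis.
From mathcomp Require Import measurable_realfun ring lra.
Import Order.TTheory GRing.Theory Num.Theory.
Import numFieldNormedType.Exports.
Local Open Scope classical_set_scope.
Local Open Scope ring_scope.

Set Implicit Arguments.
Unset Strict Implicit.
Unset Printing Implicit Defensive.

(** A solution must make the convolution of G_nu^2 with ||lambda u||_2^2 finite, and the mean of u
    alone already prevents this. Walsh integrals are centered ([walsh_integral_mean]), so E[u] = J0
    and Cauchy-Schwarz gives ||lambda u||_2 >= |lambda J0| ([solution_norm2_ge]). Centering rests on
    the independence of the noise of future sets from the past ([noise_filtration_indep]), derived
    from the product rule for disjoint sets by a pi-system argument.

    For delta_0', the integral of J0(t, y)^2 over y is a constant times t^(-3/2), not integrable at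
    t = 0, while G_nu stays bounded below at times near 1 and small y. Hence the convolution is
    infinite at (1, 0) ([star_heat_kernel_sqr_eqy]). *)

(** * Integrability and mean of centered Gaussian laws *)

Section normal_mean.
Context {R : realType}.
Implicit Types s x : R.
Local Open Scope ereal_scope.
Local Notation mu := (@lebesgue_measure R).

(** The Radon-Nikodym derivative of the law agrees almost everywhere with [normal_pdf], as both have
    the same integral over every measurable set. *)
Lemma ge0_integral_normal_prob (m s : R) (f : R -> \bar R) :
  measurable_fun [set: R] f -> (forall x, 0 <= f x) ->
  \int[normal_prob m s]_x f x = \int[mu]_x (f x * (normal_pdf m s x)%:E).
Proof.
move=> mf f0; have dom := @normal_prob_dominates R m s.
rewrite -(Radon_Nikodym_SigmaFinite.change_of_variables dom f0 measurableT mf).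
have intRN := Radon_Nikodym_SigmaFinite.f_integrable dom.
have mRN := measurable_int _ intRN.
have mpdf : measurable_fun [set: R] (fun x => (normal_pdf m s x)%:E).
  by apply/measurable_EFinP; exact: measurable_normal_pdf.
apply: ae_eq_integral => //; [exact: emeasurable_funM|exact: emeasurable_funM|].
have : ae_eq mu setT
    (Radon_Nikodym_SigmaFinite.f (normal_prob m s) mu)
    (fun x => (normal_pdf m s x)%:E).
  apply: integral_ae_eq => // E _ mE.
  by rewrite -(Radon_Nikodym_SigmaFinite.f_integral dom).
by apply: filterS => x + _ => /(_ I) ->.
Qed.

Lemma normal_pdfN s x : s != 0%R -> normal_pdf 0 s (- x) = normal_pdf 0 s x.
Proof. by move=> s0; rewrite normal_pdfE// /normal_fun !subr0 sqrrN. Qed.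

Lemma normal_probN s (E : set R) : s != 0%R -> measurable E ->
  normal_prob 0 s (-%R @^-1` E) = normal_prob 0 s E.
Proof.
move=> s0 mE; rewrite /normal_prob.
transitivity (\int[pushforward mu (-%R : R -> measurableTypeR R)]_(x in E)
    (normal_pdf 0 s x)%:E).
  rewrite ge0_integral_pushforward//=.
  - apply: eq_integral => x _.
    by rewrite /= normal_pdfN.
  - by apply/measurable_funTS/measurable_EFinP; exact: measurable_normal_pdf.
  - by move=> x _; rewrite lee_fin normal_pdf_ge0.
by apply: eq_measure_integral => A mA _; exact: lebesgue_measureN.
Qed.

Lemma normal_prob_integrable_id s : s != 0%R ->
  (normal_prob 0 s).-integrable [set: R] EFin.
Proof.
move=> s0; apply/integrableP; split; first exact/measurable_EFinP.
rewrite ge0_integral_normal_prob//; last exact: measurableT_comp.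
(* |x| <= 2|s| exp(x^2 / (4 s^2)) absorbs |x| into a Gaussian of variance *)
(* 2 s^2.                                                                  *)
pose s' : R := (Num.sqrt 2 * `|s|)%R.
have ss' : (s' ^+ 2 = 2 * s ^+ 2)%R.
  by rewrite /s' exprMn sqr_sqrtr// real_normK// num_real.
have s'0 : s' != 0%R.
  by rewrite mulf_neq0// ?normr_eq0// sqrtr_eq0 -ltNge.
(* The ratio of peaks exchanges the normalisation of variance 2 s^2 for that of variance s^2. *)
pose C : R := (2 * `|s| * (normal_peak s / normal_peak s'))%R.
have C0 : (0 <= C)%R.
  by rewrite mulr_ge0 ?divr_ge0 ?mulr_ge0 ?normal_peak_ge0.
have := integrableZl measurableT C (@integrable_normal_pdf R 0 s').
move=> /integrableP[mC]; apply: le_lt_trans; apply: ge0_le_integral => //.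
- by move=> x _; rewrite mule_ge0// lee_fin normal_pdf_ge0.
- apply: emeasurable_funM; first exact: measurableT_comp.
  by apply/measurable_EFinP; exact: measurable_normal_pdf.
- exact: measurableT_comp.
- move=> x _; rewrite /= -!EFinM lee_fin.
  rewrite [leRHS]ger0_norm; last by rewrite mulr_ge0// normal_pdf_ge0.
  rewrite !normal_pdfE// /normal_fun !subr0 ss'.
  have p'0 := normal_peak_gt0 s'0.
  have -> : (C * (normal_peak s' * expR (- x ^+ 2 / (2 * s ^+ 2 *+ 2))) =
      normal_peak s * (2 * `|s| * expR (- x ^+ 2 / (2 * s ^+ 2 *+ 2))))%R.
    by rewrite /C; field; rewrite gt_eqF.
  rewrite mulrCA ler_wpM2l ?normal_peak_ge0//.
  have -> : (- x ^+ 2 / (s ^+ 2 *+ 2) =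
      - x ^+ 2 / (2 * s ^+ 2 *+ 2) - (x / (2 * s)) ^+ 2)%R.
    by field.
  rewrite expRD mulrCA mulrC ler_wpM2r ?expR_ge0//.
  have sg : (0 < 2 * `|s|)%R by rewrite mulr_gt0// normr_gt0.
  rewrite -[leRHS]mulr1 -ler_pdivrMl// expRN.
  have -> : ((2 * `|s|)^-1 * (`|x| / expR ((x / (2 * s)) ^+ 2)) =
    `|x / (2 * s)| / expR ((x / (2 * s)) ^+ 2))%R.
    rewrite mulrA normrM normfV normrM (@ger0_norm _ 2)//.
    by rewrite [(_ * `|x|)%R]mulrC.
  rewrite ler_pdivrMr ?expR_gt0// mul1r.
  (* exp(a^2) >= 1 + a^2 >= a. *)
  apply: le_trans (expR_ge1Dx _); rewrite -real_normK ?num_real//.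
  set a := `|_|%R; have := sqr_ge0 (a - 2^-1)%R; have := sqr_ge0 a; nra.
Qed.

(** The law is invariant under x |-> -x, so the mean equals its opposite; integrability makes it a
    real number, hence 0. *)
Lemma integral_normal_prob_id s : s != 0%R ->
  \int[normal_prob 0 s]_x x%:E = 0.
Proof.
move=> s0; have inti := normal_prob_integrable_id s0.
have sym : \int[normal_prob 0 s]_x x%:E = - \int[normal_prob 0 s]_x x%:E.
  transitivity (\int[pushforward (normal_prob 0 s)
      (-%R : R -> measurableTypeR R)]_x x%:E).
    by apply: eq_measure_integral => A mA _; apply/esym; exact: normal_probN.
  have intN : (normal_prob 0 s).-integrable [set: R] (fun x => (- x)%:E).
    exact: (integrableN inti).
  rewrite integral_pushforward//= preimage_setT.
  under eq_integral do rewrite -mulN1r EFinM.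
  by rewrite integralZl//=; exact: mulN1e.
move: sym; have /fineK <- := integrable_fin_num measurableT inti.
by rewrite -EFinN => -[] h; congr EFin; lra.
Qed.

End normal_mean.

(** * Extending independence from a pi-system *)

Section independence.
Context {d : measure_display} {T : measurableType d} {R : realType}.
Variable P : probability T R.
Local Open Scope ereal_scope.

(** Both sides are finite measures in F that agree on a pi-system containing the whole space. *)
Lemma indep_g_sigma_algebra (G : set (set T)) (H : set T) :
  setI_closed G -> G setT -> G `<=` measurable -> measurable H ->
  (forall F, G F -> P (F `&` H) = P F * P H) ->
  forall F, <<s G >> F -> P (F `&` H) = P F * P H.
Proof.
move=> GI GT Gm mH GH F GF.
pose c := NngNum (fine_ge0 (measure_ge0 P H)).
have cE : c%:num%:E = P H by rewrite /= fineK// fin_num_measure.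
transitivity (mscale c P F); last by rewrite /mscale/= muleC -cE.
apply: (@g_sigma_algebra_measure_unique _ R T G Gm (fun=> setT) _ _
  (mrestr P mH) (mscale c P)) => //.
- by rewrite bigcup_const.
- move=> A GA; rewrite /mrestr/mscale/=.
  by move: (GH _ GA); rewrite muleC -cE.
- move=> _; apply: le_lt_trans (ltry 1%R).
  exact: (probability_le1 P (measurableI _ _ measurableT mH)).
Qed.

(** Additivity of the noise holds only almost surely, so events expressed through it must be
    exchanged up to null sets. *)
Lemma measure_ae_eq (A B : set T) : measurable A -> measurable B ->
  {ae P, forall w, A w <-> B w} -> P A = P B.
Proof.
move=> mA mB AB.
have E X : measurable X -> P X = \int[P]_w (\1_X w)%:E.
  by move=> mX; rewrite integral_indic// setIT.
have mI X : measurable X -> measurable_fun [set: T] (fun w => (\1_X w : R)%:E).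
  by move=> mX; apply/measurable_EFinP; exact: measurable_indic.
rewrite !E//; apply: ae_eq_integral => //; [exact: mI|exact: mI|].
apply: filterS AB => w ABw _; rewrite /indic; congr ((nat_of_bool _)%:R%:E).
by apply/idP/idP; rewrite !inE => /ABw.
Qed.

End independence.

(** * Independence of the noise over disjoint regions *)

Section white_noise_theory.
Context {d : measure_display} {T : measurableType d} {R : realType}.
Variables (P : probability T R) (W : set (R * R) -> T -> R).
Hypothesis HW : white_noise P W.
Implicit Types A B : set (R * R).
Local Open Scope ereal_scope.

Lemma noise_domainS A B : noise_domain B -> measurable A -> A `<=` B ->
  noise_domain A.
Proof.
move=> [mB B0 Boo] mA AB; split => //; first exact: subset_trans AB B0.
by apply: le_lt_trans Boo; apply: le_measure => //; rewrite inE.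
Qed.

Lemma noise_domain0 : noise_domain (set0 : set (R * R)).
Proof. by split => //; rewrite /area measure0. Qed.

Lemma noise_domainU A B : noise_domain A -> noise_domain B ->
  noise_domain (A `|` B).
Proof.
move=> [mA A0 Aoo] [mB B0 Boo]; split; [exact: measurableU| |].
  by rewrite subUset.
apply: le_lt_trans (lte_add_pinfty Aoo Boo).
exact: measureU2.
Qed.

(** Additivity on two empty sets reads x = x + x. *)
Lemma white_noise_set0 : {ae P, forall w, W set0 w = 0%R}.
Proof.
have := white_noise_additive HW noise_domain0 noise_domain0 (setI0 _).
by apply: filterS => w; rewrite setU0 => h; lra.
Qed.

Lemma white_noise_sum (I : eqType) (r : seq I) (C : I -> set (R * R)) :
  (forall i, noise_domain (C i)) ->
  (forall i j, i != j -> C i `&` C j = set0) ->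
  uniq r ->
  noise_domain (\big[setU/set0]_(i <- r) C i) /\
  {ae P, forall w,
    W (\big[setU/set0]_(i <- r) C i) w = (\sum_(i <- r) W (C i) w)%R}.
Proof.
move=> nC dC; elim: r => [_|i r IH /= /andP[ir ur]].
  rewrite big_nil; split; first exact: noise_domain0.
  by apply: filterS white_noise_set0 => w ->; rewrite big_nil.
have [nr er] := IH ur; rewrite big_cons; split; first exact: noise_domainU.
have dis : C i `&` \big[setU/set0]_(j <- r) C j = set0.
  rewrite big_distrr/= big_seq big1// => j jr; apply: dC.
  by apply: contraNneq ir => ->.
have := white_noise_additive HW (nC i) nr dis.
by apply: filterS2 er => w -> ->; rewrite big_cons.
Qed.

(** Arbitrary finite index types are wanted because atoms are indexed by sets of indices and an
    extra region by [None]. *)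
Lemma white_noise_indep_fin (I : finType) (C : I -> set (R * R))
    (E : I -> set R) :
  (forall i, noise_domain (C i)) ->
  (forall i j, i != j -> C i `&` C j = set0) ->
  (forall i, measurable (E i)) ->
  P (\bigcap_(i in [set: I]) (W (C i) @^-1` E i)) =
  \prod_(i : I) P (W (C i) @^-1` E i).
Proof.
move=> nC dC mE.
rewrite (reindex (@enum_val I predT))/=; last exact/onW_bij/enum_val_bij.
rewrite -(white_noise_independent HW) //; last first.
  by move=> i j ij; apply: dC; rewrite (inj_eq enum_val_inj).
congr (P _); apply/seteqP; split => w /= h i _; first exact: h.
by have := h (enum_rank i) Logic.I; rewrite enum_rankK.
Qed.

(** A pi-system generating the sigma-algebra of the variables [W (C i)]; a coordinate is left free
    by taking [E i] to be [setT]. *)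
Definition white_noise_cylinder {I : finType} (C : I -> set (R * R)) :
    set (set T) :=
  [set F | exists E : I -> set R, (forall i, measurable (E i)) /\
     F = \bigcap_(i in [set: I]) (W (C i) @^-1` E i)].

Lemma white_noise_measurable_preimage A (E : set R) :
  noise_domain A -> measurable E -> measurable (W A @^-1` E).
Proof.
move=> nA mE; rewrite -[X in measurable X]setTI.
exact: (white_noise_measurable HW nA).
Qed.

Lemma white_noise_cylinder_measurable (I : finType) (C : I -> set (R * R)) :
  (forall i, noise_domain (C i)) -> white_noise_cylinder C `<=` measurable.
Proof.
move=> nC _ [E [mE ->]]; apply: fin_bigcap_measurable => // i _.
exact: white_noise_measurable_preimage.
Qed.

Lemma white_noise_cylinderI (I : finType) (C : I -> set (R * R)) :
  setI_closed (white_noise_cylinder C).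
Proof.
move=> _ _ [E [mE ->]] [E' [mE' ->]]; exists (fun i => E i `&` E' i); split.
  by move=> i; exact: measurableI.
apply/seteqP; split => w /=.
  by move=> [h h'] i _; split; [exact: h|exact: h'].
by move=> h; split => i _; have [] := h i Logic.I.
Qed.

Lemma white_noise_cylinderT (I : finType) (C : I -> set (R * R)) :
  white_noise_cylinder C setT.
Proof. by exists (fun=> setT); split => //; apply/seteqP; split. Qed.

Lemma white_noise_cylinder_sum (I J : finType) (C : I -> set (R * R))
    (r : J -> seq I) (E : J -> set R) :
  (forall j, measurable (E j)) ->
  <<s white_noise_cylinder C >>
    (\bigcap_(j in [set: J])
       ((fun w => \sum_(i <- r j) W (C i) w)%R @^-1` E j)).
Proof.
move=> mE; set G := white_noise_cylinder C.
have mW i : measurable_fun [set: g_sigma_algebraType G] (W (C i)).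
  move=> _ E' mE'; rewrite setTI; apply: sub_sigma_algebra.
  exists (fun j => if j == i then E' else setT); split.
    by move=> j; case: ifP.
  apply/seteqP; split => w /=; first by move=> h j _; case: eqP => // ->.
  by move=> /(_ i Logic.I); rewrite eqxx.
suff : measurable (\bigcap_(j in [set: J])
    ((fun w : g_sigma_algebraType G => \sum_(i <- r j) W (C i) w)%R @^-1` E j)).
  by [].
apply: fin_bigcap_measurable => // j _; rewrite -[X in measurable X]setTI.
have : measurable_fun [set: g_sigma_algebraType G]
  (fun w => \sum_(i <- r j) W (C i) w)%R by exact: measurable_sum.
exact.
Qed.

(** Adjoining [A] to the family under the index [None] turns this into the product rule for one
    larger disjoint family. *)
Lemma white_noise_cylinder_indep (I : finType) (C : I -> set (R * R)) A
    (E0 : set R) :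
  (forall i, noise_domain (C i)) ->
  (forall i j, i != j -> C i `&` C j = set0) ->
  noise_domain A -> (forall i, A `&` C i = set0) -> measurable E0 ->
  forall F, white_noise_cylinder C F ->
    P (F `&` W A @^-1` E0) = P F * P (W A @^-1` E0).
Proof.
move=> nC dC nA dA mE0 _ [E [mE ->]].
pose C' (o : option I) := if o is Some i then C i else A.
pose E' (o : option I) := if o is Some i then E i else E0.
have := @white_noise_indep_fin _ C' E'.
have -> : \bigcap_(o in [set: option I]) (W (C' o) @^-1` E' o) =
    \bigcap_(i in [set: I]) (W (C i) @^-1` E i) `&` W A @^-1` E0.
  apply/seteqP; split => w /=.
    move=> h; split; last exact: (h None Logic.I).
    by move=> i _; exact: (h (Some i) Logic.I).
  by move=> [h h0] [i|] _ //; exact: (h i Logic.I).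
move=> ->; [|by case| |by case]; last first.
  by move=> [i|] [j|] //= ij; [exact: dC|by rewrite setIC].
rewrite (white_noise_indep_fin nC dC mE) (bigD1 None)//= muleC; congr (_ * _).
rewrite (reindex_omap Some id)/=; last by case.
by apply: eq_bigl => i; rewrite eqxx.
Qed.

(** Each [W (B i)] is almost surely a sum of noises of disjoint atoms, so [F] is almost surely an
    event [F'] of the sigma-algebra generated by the atoms, and all atoms are disjoint from [A]. *)
Lemma white_noise_indep_disjoint (I : finType) (B : I -> set (R * R))
    (E : I -> set R) A (E0 : set R) :
  (forall i, noise_domain (B i)) -> (forall i, measurable (E i)) ->
  noise_domain A -> (forall i, A `&` B i = set0) -> measurable E0 ->
  let F := \bigcap_(i in [set: I]) (W (B i) @^-1` E i) in
  P (F `&` W A @^-1` E0) = P F * P (W A @^-1` E0).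
Proof.
move=> nB mE nA dA mE0 F.
pose U := \big[setU/set0]_(i : I) B i.
(* The B i may overlap: they are cut into the atoms of the algebra that they *)
(* generate, indexed by the set S of those i with atom S `<=` B i.           *)
pose atom (S : {set I}) := U `&`
  \bigcap_(i in [set: I]) (if i \in S then B i else ~` B i).
have nU : noise_domain U.
  apply: (big_ind (fun X => noise_domain X)) => //; first exact: noise_domain0.
  exact: noise_domainU.
have UE z : U z <-> exists i, B i z.
  rewrite /U -bigcup_seq; split => [[i _ Biz]|[i Biz]]; exists i => //.
  exact: mem_index_enum.
have atomE S z : atom S z <-> U z /\ forall i, B i z <-> i \in S.
  split => [[Uz h]|[Uz h]]; split => // i.
    by have /= := h i Logic.I; case: ifP => iS Biz; split.
  by move=> _ /=; case: ifP => iS; [apply/h|move=> /h; rewrite iS].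
(* The factor [U] keeps the area finite: for empty [S], the intersection of the complements alone
   has infinite area. *)
have natom S : noise_domain (atom S).
  have mB i : measurable (B i) by have [] := nB i.
  apply: (noise_domainS nU); last by move=> z [].
  apply: measurableI; first by case: nU.
  apply: fin_bigcap_measurable => // i _; case: ifP => _ //.
  exact: measurableC.
have datom S S' : S != S' -> atom S `&` atom S' = set0.
  move=> /eqP SS'; apply/seteqP; split => // z [/atomE[_ h] /atomE[_ h']].
  by apply: SS'; apply/setP => i; apply/idP/idP => [/h/h'|/h'/h].
pose over (i : I) := enum [pred S : {set I} | i \in S].
have BE i : B i = \big[setU/set0]_(S <- over i) atom S.
  rewrite -bigcup_seq; apply/seteqP; split => z.
    move=> Biz; exists [set j | `[< B j z >]]%SET.
      by rewrite /= mem_enum inE/= inE; apply/asboolP.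
    apply/atomE; split; first by apply/UE; exists i.
    by move=> j; rewrite inE; split => /asboolP.
  by move=> [S /=]; rewrite mem_enum inE/= => iS /atomE[_ ->].
pose F' := \bigcap_(i in [set: I])
  ((fun w => \sum_(S <- over i) W (atom S) w)%R @^-1` E i).
have mH : measurable (W A @^-1` E0) by exact: white_noise_measurable_preimage.
have mF : measurable F.
  apply: fin_bigcap_measurable => // i _.
  exact: white_noise_measurable_preimage.
have sF' : <<s white_noise_cylinder atom >> F'.
  exact: white_noise_cylinder_sum.
have mF' : measurable F'.
  apply: smallest_sub sF'; first exact: sigma_algebra_measurable.
  exact: white_noise_cylinder_measurable.
have aeB : {ae P, forall w i,
    W (B i) w = (\sum_(S <- over i) W (atom S) w)%R}.
  apply: filter_forall => i; rewrite [in B i]BE.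
  by have [_] := white_noise_sum natom datom
    (enum_uniq [pred S : {set I} | i \in S]).
have FF' : {ae P, forall w, F w <-> F' w}.
  apply: filterS aeB => w h; split => Fw i _ /=; have := Fw i Logic.I;
  by rewrite /= h.
rewrite (measure_ae_eq mF mF' FF').
have -> : P (F `&` W A @^-1` E0) = P (F' `&` W A @^-1` E0).
  apply: measure_ae_eq; [exact: measurableI|exact: measurableI|].
  by apply: filterS FF' => w h; split => -[/h].
apply: (indep_g_sigma_algebra _ _ _ mH _ sF').
- exact: white_noise_cylinderI.
- exact: white_noise_cylinderT.
- exact: white_noise_cylinder_measurable.
- apply: white_noise_cylinder_indep => // S.
  apply/seteqP; split => // z [Az [/UE[i Biz] _]].
  by rewrite -[set0](dA i).
Qed.

End white_noise_theory.

(** * Products of independent variables *)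

Section indep_product.
Context {d : measure_display} {T : measurableType d} {R : realType}.
Variables (P : probability T R).
Local Open Scope ereal_scope.

(** Independence makes the law of (X, Y) the product of the marginals, and Fubini integrates y
    first, giving 0. The bound on X ensures integrability. *)
Lemma integral_indep_mean0 (X Y : T -> R) (M : R) :
  measurable_fun [set: T] X -> measurable_fun [set: T] Y ->
  (forall w, `|X w| <= M)%R ->
  P.-integrable [set: T] (EFin \o Y) -> \int[P]_w (Y w)%:E = 0 ->
  (forall E1 E2, measurable E1 -> measurable E2 ->
    P (X @^-1` E1 `&` Y @^-1` E2) = P (X @^-1` E1) * P (Y @^-1` E2)) ->
  P.-integrable [set: T] (fun w => (X w * Y w)%:E) /\
  \int[P]_w (X w * Y w)%:E = 0.
Proof.
move=> mX mY XM intY Y0 indep.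
have intXY : P.-integrable [set: T] (fun w => (X w * Y w)%:E).
  have := integrableZl measurableT M (integrable_abse intY).
  apply: le_integrable => //; first exact/measurable_EFinP/measurable_funM.
  move=> w _ /=; rewrite lee_fin !normrM normr_id ler_wpM2r//.
  exact: le_trans (XM w) (ler_norm M).
split => //.
pose X' : {mfun T >-> R} :=
  HB.pack X (isMeasurableFun.Build _ _ _ _ X mX).
pose Y' : {mfun T >-> R} :=
  HB.pack Y (isMeasurableFun.Build _ _ _ _ Y mY).
pose Z w : R * R := (X w, Y w).
have mZ : measurable_fun [set: T] Z by exact/measurable_fun_pairP.
pose f (z : R * R) := (z.1 * z.2)%:E.
have mf : measurable_fun setT f by exact/measurable_EFinP/measurable_funM.
have prodE A : measurable A ->
    (distribution P X' \x distribution P Y') A = pushforward P Z A.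
  by move=> mA; apply: product_measure_unique => // E1 E2 mE1 mE2; exact: indep.
have intf : (distribution P X' \x distribution P Y').-integrable setT f.
  apply/integrableP; split => //.
  have [_] := integrableP _ _ _
    (integrable_pushforward mZ mf intXY measurableT).
  congr (_ < _); apply: eq_measure_integral => A mA _.
  exact/esym/prodE.
transitivity (\int[pushforward P Z]_z f z).
  by rewrite integral_pushforward.
transitivity (\int[distribution P X' \x distribution P Y']_z f z).
  by apply: eq_measure_integral => A mA _; exact/esym/prodE.
rewrite -integral12_prod_meas1//; apply: integral0_eq => x _.
suff : \int[distribution P Y']_y f (x, y) = 0 by [].
rewrite /f/=; under eq_integral do rewrite EFinM.
have mid : measurable_fun [set: R] (EFin : R -> \bar R).
  exact/measurable_EFinP.
rewrite integralZl//; last exact: (integrable_pushforward mY mid intY).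
by rewrite /distribution integral_pushforward//= Y0 mule0.
Qed.

End indep_product.

(** * Walsh integrals are centered *)

Section walsh_mean.
Context {d : measure_display} {T : measurableType d} {R : realType}.
Variables (P : probability T R) (W : set (R * R) -> T -> R).
Hypothesis HW : white_noise P W.
Local Open Scope ereal_scope.

Lemma noise_filtration_measurable (a : R) :
  noise_filtration P W a `<=` measurable.
Proof.
apply: smallest_sub; first exact: sigma_algebra_measurable.
move=> F [[A [E [nA _ mE ->]]]|[]//].
exact: (white_noise_measurable_preimage HW).
Qed.

(** Past regions are disjoint from [A], and null sets are independent of everything. The generators
    of the filtration are not closed under intersection, so they are enlarged to finite
    intersections [cyl] together with the null sets. *)
Lemma noise_filtration_indep (a : R) (A : set (R * R)) (E0 : set R) :
  noise_domain A -> (forall z, A z -> (a < z.1)%R) -> measurable E0 ->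
  forall F, noise_filtration P W a F ->
    P (F `&` W A @^-1` E0) = P F * P (W A @^-1` E0).
Proof.
move=> nA Aa mE0.
pose cyl F := exists (I : finType) (B : I -> set (R * R)) (E : I -> set R),
  [/\ forall i, noise_domain (B i), forall i, B i `<=` [set z | z.1 <= a]%R,
      forall i, measurable (E i) &
      F = \bigcap_(i in [set: I]) (W (B i) @^-1` E i)].
pose G := cyl `|` [set N | measurable N /\ P N = 0].
have mH : measurable (W A @^-1` E0).
  exact: (white_noise_measurable_preimage HW).
have Gm : G `<=` measurable.
  move=> F [[I [B [E [nB _ mE ->]]]]|[]//].
  apply: fin_bigcap_measurable => // i _.
  exact: (white_noise_measurable_preimage HW).
have null X Y : measurable X -> measurable Y -> P X = 0 ->
    measurable (X `&` Y) /\ P (X `&` Y) = 0.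
  move=> mX mY X0; split; first exact: measurableI.
  by apply: (subset_measure0 (B := X)) => //; exact: measurableI.
have GI : setI_closed G.
  move=> X Y GX GY; have mX := Gm _ GX; have mY := Gm _ GY.
  case: GX => [[I [B [E [nB Ba mE XE]]]]|[_ X0]]; last by right; exact: null.
  case: GY => [[J [B' [E' [nB' Ba' mE' YE]]]]|[_ Y0]]; last first.
    by right; rewrite setIC; exact: null.
  left; rewrite XE YE.
  exists (I + J)%type, (fun k => match k with inl i => B i | inr j => B' j end),
    (fun k => match k with inl i => E i | inr j => E' j end); split.
  - by case.
  - by case.
  - by case.
  apply/seteqP; split => w /=.
    by move=> [h h'] [i|j] _ /=; [exact: (h i Logic.I)|exact: (h' j Logic.I)].
  move=> h; split=> i _; first exact: (h (inl i) Logic.I).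
  exact: (h (inr i) Logic.I).
have GT : G setT.
  left; exists 'I_0, (fun=> set0), (fun=> setT); split.
  - by case.
  - by case.
  - by case.
  by apply/seteqP; split => // w _ [].
have GH F : G F -> P (F `&` W A @^-1` E0) = P F * P (W A @^-1` E0).
  case=> [[I [B [E [nB Ba mE ->]]]]|[mF F0]].
    apply: (white_noise_indep_disjoint HW) => // i.
    apply/seteqP; split => // z [/Aa az /Ba /=].
    by rewrite leNgt az.
  by rewrite F0 mul0e; case: (null _ _ mF mH F0).
move=> F sF; apply: (indep_g_sigma_algebra GI GT Gm mH GH).
apply: (smallest_sub (smallest_sigma_algebra setT G) _ sF) => {F sF}F genF.
apply: sub_sigma_algebra.
case: genF => [[B [E [nB Ba mE ->]]]|N0]; last by right.
left; exists unit, (fun=> B), (fun=> E); split => //.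
by apply/seteqP; split => [w h _ _//|w /(_ tt Logic.I)].
Qed.

Lemma white_noise_mean (A : set (R * R)) : noise_domain A ->
  P.-integrable setT (EFin \o W A) /\ \int[P]_w (W A w)%:E = 0.
Proof.
move=> nA; have mW := white_noise_measurable HW nA.
set v := fine (area A).
pose L := pushforward P (W A : T -> measurableTypeR R).
(* [centered_gaussian] is only a set function; in each of its two cases a genuine measure [Q]
   represents it. *)
have LE : exists Q : {measure set (measurableTypeR R) -> \bar R},
    [/\ forall E, measurable E -> L E = Q E,
        Q.-integrable [set: R] EFin & \int[Q]_x x%:E = 0].
  have LE E : measurable E -> L E = centered_gaussian v E.
    by move=> mE; exact: (white_noise_gaussian HW nA mE).
  have [v0|v0] := eqVneq v 0%R.
    exists (dirac (0%R : measurableTypeR R)); split.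
    - by move=> E mE; rewrite LE// /centered_gaussian v0 eqxx.
    - apply/integrableP; split; first exact/measurable_EFinP.
      rewrite integral_dirac//; first by rewrite abse0 mule0.
      by apply: measurableT_comp => //; exact/measurable_EFinP.
    - by rewrite integral_dirac// ?mule0//; exact/measurable_EFinP.
  have s0 : Num.sqrt v != 0%R.
    have v_ge0 : (0 <= v)%R by rewrite fine_ge0// measure_ge0.
    by rewrite sqrtr_eq0 -ltNge lt_def v0.
  exists (normal_prob 0 (Num.sqrt v)); split.
  - by move=> E mE; rewrite LE// /centered_gaussian (negbTE v0).
  - exact: normal_prob_integrable_id.
  - exact: integral_normal_prob_id.
case: LE => Q [LQ intQ meanQ].
have LQE (f : R -> \bar R) : \int[Q]_x f x =
    \int[pushforward P (W A : T -> measurableTypeR R)]_x f x.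
  by apply: eq_measure_integral => E mE _; rewrite -LQ.
have intW : P.-integrable setT (EFin \o W A).
  apply/integrableP; split; first exact/measurable_EFinP.
  move/integrableP : intQ => [_]; rewrite LQE ge0_integral_pushforward//=.
  by apply/measurableT_comp => //; exact/measurable_EFinP.
split => //; rewrite -meanQ LQE integral_pushforward//=.
Qed.

(** The coefficient is known at time [el_start e], and the half-open interval puts the region
    strictly later, so the two factors are independent. *)
Lemma elementary_int_mean (e : elementary T R) (t : R) :
  elementary_wf P W e ->
  P.-integrable [set: T] (EFin \o elementary_int W t e) /\
  \int[P]_w (elementary_int W t e w)%:E = 0.
Proof.
move=> [/andP[a0 ab] mX [M XM] mA Aoo].
set B := `]Num.min (el_start e) t, Num.min (el_end e) t] `*` el_space e.
(* When t <= el_start e the interval is empty. *)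
have Ba z : B z -> (el_start e < z.1)%R.
  move=> [/= + _]; rewrite in_itv/= gt_min le_min => /andP[/orP[//|tz]].
  by move=> /andP[_ /(lt_le_trans tz)]; rewrite ltxx.
have nB : noise_domain B.
  split.
  - exact: measurableX.
  - by move=> z /Ba/ltW; exact: le_trans.
  - rewrite /area product_measure1E//; apply: lte_mul_pinfty => //.
    have itv_fin (x y : R) : lebesgue_measure `]x, y]%classic \is a fin_num.
      by rewrite lebesgue_measure_itv/=; case: ifP.
    exact: itv_fin.
have [intB B0] := white_noise_mean nB.
apply: (integral_indep_mean0 (M := M)) => //.
- move=> _ E mE; rewrite setTI; apply: noise_filtration_measurable; exact: mX.
- exact: (white_noise_measurable HW nB).
- move=> E1 E2 mE1 mE2; apply: (noise_filtration_indep (a := el_start e)) => //.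
  exact: mX.
Qed.

(** Cauchy-Schwarz against the constant 1, whose norm is 1 under a probability. *)
Lemma le_abse_integral_norm2 (Z : T -> R) : measurable_fun [set: T] Z ->
  `|\int[P]_w (Z w)%:E| <= norm2 P Z.
Proof.
move=> mZ; have mZ' : measurable_fun [set: T] (EFin \o Z).
  exact/measurable_EFinP.
apply: le_trans (le_abse_integral P measurableT mZ') _.
have h2 : (2^-1 + 2^-1 = 1 :> R)%R by lra.
have N1 : 'N[P]_2%:E [EFin \o cst 1%R] = 1.
  transitivity ('N[P]_2%:E [cst 1]) => //.
  rewrite Lnorm_cst1.
  transitivity ((1 : \bar R) `^ 2^-1); last by rewrite poweR1r.
  congr (_ `^ _). exact: probability_setT.
have := @hoelder _ _ _ P Z (cst 1%R) 2 2 mZ (measurable_cst _)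
  (ltr0Sn _ 1) (ltr0Sn _ 1) h2.
rewrite N1 mule1 Lnorm1 /norm2; congr (_ <= _).
by apply: eq_integral => w _ /=; rewrite mulr1.
Qed.

Lemma simple_int_mean (S : simple T R) (t : R) : simple_wf P W S ->
  P.-integrable [set: T] (EFin \o simple_int W t S) /\
  \int[P]_w (simple_int W t S w)%:E = 0.
Proof.
move=> wfS.
have E w : (simple_int W t S w)%:E =
    \sum_(i <- index_enum _) (elementary_int W t (simple_term S i) w)%:E.
  by rewrite /simple_int -sumEFin.
have int i :
    P.-integrable [set: T] (EFin \o elementary_int W t (simple_term S i)).
  by have [] := elementary_int_mean t (wfS i).
split.
  apply: (eq_integrable measurableT (fun w =>
    \sum_(i <- index_enum _) (elementary_int W t (simple_term S i) w)%:E)).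
    by move=> w _; rewrite /= E.
  by apply: integrable_sum => // i _; exact: int.
under eq_integral do rewrite E.
rewrite integral_sum// big1// => i _.
by have [] := elementary_int_mean t (wfS i).
Qed.

(** With I_n the simple integrals, |E[I]| = |E[I_n - I]| <= ||I_n - I||_2, which tends to 0. *)
Lemma walsh_integral_mean (t : R) (f : R -> R -> T -> R) (I : T -> R) :
  is_walsh_integral P W t f I ->
  P.-integrable [set: T] (EFin \o I) /\ \int[P]_w (I w)%:E = 0.
Proof.
move=> [_ I2 [S [wfS _ SI]]].
have intI : P.-integrable [set: T] (EFin \o I).
  apply/Lfun1_integrable; apply: Lfun_subset12 => //.
  exact: fin_num_measure.
split => //; apply/eqP; rewrite -abse_eq0 eq_le abse_ge0 andbT.
rewrite -(cvg_lim _ SI)//; apply: lime_ge; first by apply/cvg_ex; exists 0.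
apply: nearW => n; have [intS S0] := simple_int_mean t (wfS n).
have -> : `|\int[P]_w (I w)%:E| =
    `|\int[P]_w (simple_int W t (S n) w - I w)%:E|.
  under [in RHS]eq_integral do rewrite EFinB.
  by rewrite integralB//= S0 sub0e abseN.
apply: le_abse_integral_norm2; apply: measurable_funB.
  by apply/measurable_EFinP; exact: measurable_int intS.
by apply/measurable_EFinP; exact: measurable_int intI.
Qed.

Lemma solution_norm2_ge (nu lambda : R) (mu : (R -> R) -> R)
    (u : R -> R -> T -> R) (t x : R) :
  random_field_solution P W nu (fun z => lambda * z)%R mu u -> (0 < t)%R ->
  (`|lambda * J0 nu mu t x|%R)%:E <= norm2 P (fun w => lambda * u t x w)%R.
Proof.
move=> [adapted _ _ [I [walshI _ uI]]] t0.
have [intI I0] := walsh_integral_mean (walshI t x t0).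
have mu_ : measurable_fun [set: T] (u t x).
  move=> _ E mE; rewrite setTI; apply: noise_filtration_measurable.
  exact: (adapted t x t0).
have mI : measurable_fun [set: T] (I t x).
  by apply/measurable_EFinP; exact: measurable_int intI.
have mlu : measurable_fun [set: T] (fun w => lambda * u t x w)%R.
  exact: measurable_funM.
apply: le_trans (le_abse_integral_norm2 mlu).
suff -> : \int[P]_w (lambda * u t x w)%:E = (lambda * J0 nu mu t x)%:E by [].
transitivity (\int[P]_w (lambda%:E * ((J0 nu mu t x)%:E + (I t x w)%:E))).
  apply: ae_eq_integral => //.
  - exact/measurable_EFinP.
  - apply/measurable_EFinP; apply: measurable_funM => //.
    exact: measurable_funD.
  - by apply: filterS (uI t x t0) => w -> _.
have intc : P.-integrable [set: T] (cst (J0 nu mu t x)%:E).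
  exact: finite_measure_integrable_cst.
rewrite integralZl//; last exact: integrableD.
rewrite integralD// I0 adde0 integral_cst//.
by rewrite [X in _ * (_ * X)](_ : _ = 1) ?mule1//; exact: probability_setT.
Qed.

End walsh_mean.

(** * The heat kernel and its derivative *)

Section heat_kernel_bounds.
Context {R : realType}.
Implicit Types nu t x y e : R.

Lemma heat_kernel_ge0 nu t x : 0 <= heat_kernel nu t x.
Proof. by rewrite /heat_kernel; case: ifP. Qed.

(** The sign in [delta0_prime] cancels the one from differentiating y |-> G(x - y), leaving the
    x-derivative of G. *)
Lemma J0_delta0_prime nu t x : 0 < nu -> 0 < t ->
  J0 nu (@delta0_prime R) t x = - (x / (nu * t)) * heat_kernel nu t x.
Proof.
move=> nu0 t0; rewrite /J0 /delta0_prime.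
set c := (Num.sqrt (2 * pi * nu * t))^-1.
have hE z : heat_kernel nu t z = c * expR (- (z ^+ 2) / (2 * nu * t)).
  by rewrite /heat_kernel t0.
under eq_fun do rewrite hE.
rewrite hE derive1E.
have h : is_derive (0 : R) 1
  (fun y => c * expR (- ((x - y) ^+ 2) / (2 * nu * t)))
  (x / (nu * t) * (c * expR (- (x ^+ 2) / (2 * nu * t)))).
  apply: is_derive_eq.
  by rewrite /GRing.scale /= !subr0; field; rewrite !gt_eqF.
by rewrite (@derive_val _ _ _ _ _ _ _ h) [RHS]mulNr.
Qed.

(** On the parabolic region x^2 <= r t the exponent is at least -r / (2 nu); [s] controls the
    prefactor, and is taken to be 2 nu at times of order 1 and 2 nu e^2 near the singularity. *)
Lemma heat_kernel_ge nu t x s r : 0 < nu -> 0 < t -> 0 < s ->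
  2 * nu * t <= s -> x ^+ 2 <= r * t ->
  (Num.sqrt (pi * s))^-1 * expR (- (r / (2 * nu))) <= heat_kernel nu t x.
Proof.
move=> nu0 t0 s0 ts xr; rewrite /heat_kernel t0.
have pi0 := pi_gt0 R.
have p0 : 0 < 2 * pi * nu * t by rewrite !mulr_gt0.
apply: ler_pM; rewrite ?invr_ge0 ?expR_ge0//.
  rewrite lef_pV2 ?posrE ?sqrtr_gt0 ?mulr_gt0//.
  rewrite ler_sqrt ?mulr_ge0 ?(ltW pi0) ?(ltW s0)//.
  by rewrite -!mulrA mulrCA ler_wpM2l ?pi_ge0// !mulrA.
rewrite ler_expR mulNr lerN2 ler_pdivrMr ?mulr_gt0//.
rewrite [leRHS](_ : _ = r * t)//.
by field; rewrite gt_eqF.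
Qed.

End heat_kernel_bounds.

(** * Monotonicity of integrals of nonnegative functions *)

Section ge0_integral_monotone.
Context {d : measure_display} {T : measurableType d} {R : realType}.
Variable mu : {measure set T -> \bar R}.
Local Open Scope ereal_scope.

(* The integral of a nonnegative function is defined as a supremum over       *)
(* simple functions below it, so no measurability is needed; hence none has   *)
(* to be proved for (s, y) |-> ||u(s, y)||_2.                                 *)
Lemma ge0_le_integral_nonmeasurable (D : set T) (f g : T -> \bar R) :
  (forall x, D x -> 0 <= f x) -> (forall x, D x -> f x <= g x) ->
  \int[mu]_(x in D) f x <= \int[mu]_(x in D) g x.
Proof.
move=> f0 fg; have g0 x : D x -> 0 <= g x.
  by move=> Dx; exact: le_trans (f0 x Dx) (fg x Dx).
rewrite !ge0_integralE//; apply: le_ereal_sup => _ [h hf <-]; exists h => //= x.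
apply: le_trans (hf x) _; rewrite !patchE; case: ifPn => // /set_mem; exact: fg.
Qed.

Lemma ge0_subset_integral_nonmeasurable (A B : set T) (f : T -> \bar R) :
  A `<=` B -> (forall x, B x -> 0 <= f x) ->
  \int[mu]_(x in A) f x <= \int[mu]_(x in B) f x.
Proof.
move=> AB f0; rewrite integral_mkcond [leRHS]integral_mkcond.
apply: ge0_le_integral_nonmeasurable => x _.
  by rewrite patchE; case: ifPn => // /set_mem/AB/f0.
rewrite !patchE; case: ifPn => [/set_mem xA|_].
  by rewrite mem_set//; exact: AB.
by case: ifPn => // /set_mem/f0.
Qed.

Lemma ge0_integral_ge_cst (A B : set T) (f : T -> \bar R) (c : R) :
  measurable A -> A `<=` B -> (0 <= c)%R -> (forall x, B x -> 0 <= f x) ->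
  (forall x, A x -> c%:E <= f x) ->
  c%:E * mu A <= \int[mu]_(x in B) f x.
Proof.
move=> mA AB c0 f0 cf.
apply: le_trans (ge0_subset_integral_nonmeasurable AB f0).
by rewrite -integral_cst//; exact: ge0_le_integral_nonmeasurable.
Qed.

End ge0_integral_monotone.

(** * Divergence of the convolution at (1, 0) *)

Section blow_up.
Context {R : realType}.
Variables (nu : R) (nu_gt0 : 0 < nu).

(** The 2 in the exponent is r for y^2 <= 1 <= 2 s. *)
Let c1 := (Num.sqrt (pi * (2 * nu)))^-1 * expR (- (2 / (2 * nu))).
(** The 8 is r for y^2 <= 4 e^2 <= 8 t; the factor 1 / nu comes from y / (nu t) >= 1 / (nu e). *)
Let c2 := nu^-1 * ((Num.sqrt (pi * (2 * nu)))^-1 * expR (- (8 / (2 * nu)))).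

Let c1_gt0 : 0 < c1.
Proof.
by rewrite mulr_gt0 ?expR_gt0// invr_gt0 sqrtr_gt0 !mulr_gt0// pi_gt0.
Qed.

Let c2_gt0 : 0 < c2.
Proof.
by rewrite !mulr_gt0 ?expR_gt0// invr_gt0// sqrtr_gt0 !mulr_gt0// pi_gt0.
Qed.

Let heat_ge s y : 2^-1 <= s <= 1 -> y ^+ 2 <= 1 -> c1 <= heat_kernel nu s y.
Proof.
move=> /andP[s12 s1] y1.
have s0 : 0 < s by apply: lt_le_trans s12; rewrite invr_gt0.
apply: heat_kernel_ge => //; first by rewrite mulr_gt0.
  by rewrite -[leRHS]mulr1 ler_wpM2l// mulr_ge0// ltW.
lra.
Qed.

Let J0_ge e t y : 0 < e -> e ^+ 2 / 2 <= t <= e ^+ 2 -> e <= y <= 2 * e ->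
  c2 / e ^+ 2 <= `|J0 nu (@delta0_prime R) t (- y)|.
Proof.
move=> e0 /andP[t1 t2] /andP[y1 y2].
have e20 : 0 < e ^+ 2 by rewrite exprn_gt0.
have t0 : 0 < t by apply: lt_le_trans t1; rewrite divr_gt0.
have y0 : 0 < y by exact: lt_le_trans y1.
rewrite J0_delta0_prime// !mulNr opprK normrM.
rewrite [X in _ <= _ * X]ger0_norm ?heat_kernel_ge0//.
rewrite gtr0_norm ?divr_gt0 ?mulr_gt0//.
have h := @heat_kernel_ge R nu t (- y) (2 * nu * e ^+ 2) 8 nu_gt0 t0.
have {}h : (Num.sqrt (pi * (2 * nu)))^-1 * expR (- (8 / (2 * nu))) / e <=
    heat_kernel nu t (- y).
  apply: le_trans (h _ _ _); first last.
  - have : y * y <= (2 * e) * (2 * e) by rewrite ler_pM// ltW.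
    by move: t1; rewrite sqrrN !expr2; lra.
  - by rewrite ler_wpM2l// mulr_ge0// ltW.
  - by rewrite !mulr_gt0.
  have sqE : Num.sqrt (pi * (2 * nu * e ^+ 2)) = Num.sqrt (pi * (2 * nu)) * e.
    rewrite [X in Num.sqrt X](_ : _ = pi * (2 * nu) * e ^+ 2); last by ring.
    rewrite (@sqrtrM _ (pi * (2 * nu)) (e ^+ 2)) ?sqrtr_sqr ?(gtr0_norm e0)//.
    by rewrite !mulr_ge0 ?pi_ge0// ltW.
  by rewrite sqE [X in _ <= X * _]invfM [leRHS]mulrAC.
have q : nu^-1 / e <= y / (nu * t).
  rewrite ler_pdivlMr ?mulr_gt0// mulrACA mulVf ?gt_eqF// mul1r.
  by apply: le_trans y1; rewrite ler_pdivrMl// -expr2.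
apply: le_trans (ler_pM _ _ q h).
- rewrite /c2; set A := (_ * expR _).
  rewrite [leLHS](_ : _ = nu^-1 / e * (A / e))//.
  by rewrite expr2 invfM; ring.
- by rewrite divr_ge0 ?invr_ge0 ?ltW.
- by rewrite divr_ge0 ?mulr_ge0 ?invr_ge0 ?sqrtr_ge0 ?expR_ge0// ltW.
Qed.

Local Open Scope ereal_scope.

(** [N] stands for the norm of lambda u. Restricting to 1 - s between e^2 / 2 and e^2 and to y in
    [e, 2 e] leaves an integrand of at least [k], of order e^-4, on a box of area e^3 / 2. The bound
    e <= 1/2 keeps s >= 1/2 and y <= 1, where [c1] applies. *)
Let star_ge (lambda : R) (N : R -> R -> \bar R) :
  (forall t x, 0 <= N t x) ->
  (forall t x, (0 < t)%R ->
    (`|lambda * J0 nu (@delta0_prime R) t x|%R)%:E <= N t x) ->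
  forall e : R, (0 < e <= 2^-1)%R ->
  ((c1 * `|lambda| * c2) ^+ 2 / 2 / e)%:E <=
  star (fun s y => (heat_kernel nu s y ^+ 2)%:E) (fun s y => N s y ^+ 2) 1 0.
Proof.
move=> N0 NJ e /andP[e0 e2].
have e20 : (0 < e ^+ 2)%R by rewrite exprn_gt0.
have e21 : (e ^+ 2 <= 2^-1)%R by rewrite expr2; nra.
pose k : R := (c1 ^+ 2 * (`|lambda| * (c2 / e ^+ 2)) ^+ 2)%R.
have k0 : (0 <= k)%R by rewrite mulr_ge0 ?sqr_ge0.
have F0 s y : 0 <= (heat_kernel nu s y ^+ 2)%:E * N (1 - s)%R (0 - y)%R ^+ 2.
  by rewrite mule_ge0// ?lee_fin ?sqr_ge0// expe2 mule_ge0.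
have Fk s y : (1 - e ^+ 2 < s < 1 - e ^+ 2 / 2)%R -> (e <= y <= 2 * e)%R ->
    k%:E <= (heat_kernel nu s y ^+ 2)%:E * N (1 - s)%R (0 - y)%R ^+ 2.
  move=> /andP[s1 s2] ye.
  have h1 : (c1 <= heat_kernel nu s y)%R.
    apply: heat_ge; first lra.
    by case/andP: ye => y1 y2; rewrite expr2; nra.
  have h2 : (`|lambda| * (c2 / e ^+ 2))%:E <= N (1 - s)%R (0 - y)%R.
    apply: le_trans (NJ _ _ _); last lra.
    rewrite lee_fin normrM ler_wpM2l// sub0r; apply: J0_ge => //; lra.
  rewrite /k EFinM; apply: lee_pmul.
  - by rewrite lee_fin sqr_ge0.
  - by rewrite lee_fin sqr_ge0.
  - by rewrite lee_fin lerXn2r ?nnegrE ?heat_kernel_ge0// ltW.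
  - have c0 : 0 <= (`|lambda| * (c2 / e ^+ 2))%:E.
      by rewrite lee_fin mulr_ge0// divr_ge0 ?ltW.
    by rewrite expr2 EFinM expe2; apply: lee_pmul.
have inner s : (1 - e ^+ 2 < s < 1 - e ^+ 2 / 2)%R -> (k * e)%:E <=
    \int[lebesgue_measure]_(y in [set: R])
      ((heat_kernel nu s y ^+ 2)%:E * N (1 - s)%R (0 - y)%R ^+ 2).
  move=> hs.
  have L : lebesgue_measure `[e, (2 * e)%R]%classic = e%:E.
    rewrite lebesgue_measure_itv/= lte_fin ltr_pMl// ltr1n -EFinD.
    by congr EFin; lra.
  rewrite EFinM -[in X in X <= _]L.
  apply: (@ge0_integral_ge_cst _ (measurableTypeR R) R lebesgue_measure) => //.
  by move=> y /=; rewrite in_itv/=; exact: Fk.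
have L : lebesgue_measure `](1 - e ^+ 2)%R, (1 - e ^+ 2 / 2)%R[%classic =
    (e ^+ 2 / 2)%:E.
  rewrite lebesgue_measure_itv/= lte_fin ifT; last lra.
  by rewrite -EFinD; congr EFin; lra.
have -> : ((c1 * `|lambda| * c2) ^+ 2 / 2 / e)%:E =
    (k * e)%:E * (e ^+ 2 / 2)%:E.
  by rewrite -EFinM; congr EFin; rewrite /k; field; rewrite gt_eqF.
rewrite -[in X in X <= _]L.
apply: (@ge0_integral_ge_cst _ (measurableTypeR R) R lebesgue_measure) => //.
- by move=> s /=; rewrite !in_itv/= => /andP[s1 s2]; apply/andP; split; lra.
- by rewrite mulr_ge0// ltW.
- by move=> s _; apply: integral_ge0 => y _; exact: F0.
Qed.

Lemma star_heat_kernel_sqr_eqy (lambda : R) (N : R -> R -> \bar R) :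
  lambda != 0%R -> (forall t x, 0 <= N t x) ->
  (forall t x, (0 < t)%R ->
    (`|lambda * J0 nu (@delta0_prime R) t x|%R)%:E <= N t x) ->
  star (fun s y => (heat_kernel nu s y ^+ 2)%:E)
    (fun s y => N s y ^+ 2) 1 0 = +oo.
Proof.
move=> l0 N0 NJ; apply/eqyP => A A0.
pose K : R := ((c1 * `|lambda| * c2) ^+ 2 / 2)%R.
have K0 : (0 < K)%R.
  by rewrite divr_gt0 ?exprn_gt0 ?(mulr_gt0 (mulr_gt0 c1_gt0 _)) ?normr_gt0.
(* The choice e <= K / A makes the lower bound K / e at least [A]. *)
have e0 : (0 < Num.min 2^-1 (K / A))%R.
  by rewrite lt_min invr_gt0 ltr0n divr_gt0.
have : (0 < Num.min 2^-1 (K / A) <= 2^-1)%R.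
  by rewrite e0 ge_min lexx.
move=> /(star_ge N0 NJ); apply: le_trans.
by rewrite lee_fin -/K ler_pdivlMr// mulrC -ler_pdivlMr// ge_min lexx orbT.
Qed.

End blow_up.

Unset Implicit Arguments.

Theorem proposition2p11 (R : realType) (d : measure_display)
    (T : measurableType d) (P : probability T R) (W : set (R * R) -> T -> R)
    (nu lambda : R)
    (P_complete : measure_is_complete P)
    (W_noise : white_noise P W)
    (nu_gt0 : 0 < nu)
    (lambda_neq0 : lambda != 0) :
  ~ exists u : R -> R -> T -> R,
      random_field_solution P W nu (fun z => lambda * z) (@delta0_prime R) u.
Proof.
move=> [u sol]; have [_ _ finite_star _] := sol.
(* At (1, 0) the time 1 - s at which u is evaluated reaches the singularity as s tends to 1. *)
have := finite_star 1 0 ltr01.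
have normE := star_heat_kernel_sqr_eqy nu_gt0 lambda_neq0
  (N := fun s y => norm2 P (fun w => lambda * u s y w)).
rewrite normE ?ltxx// => t x; first exact: Lnorm_ge0.
exact: (solution_norm2_ge W_noise x sol).
Qed.
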